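(* Let $r$ and $n$ be positive integers and let $h(x)$ be a polynomial with nonnegative (real) coefficients. If $h(x)$ has only negative real zeros, then the polynomial sequence $\left(U_{r,r-1}^{n}\,h(x),\ldots, U_{r,1}^{n}\,h(x), U_{r,0}^{n}\,h(x)\right)$ is interlacing.
   Context: Sections of a polynomial. Fix a positive integer $r$. For a polynomial (or formal power series) $f(x)$, the series $f^{\langle r,0 \rangle}(x),\ldots,f^{\langle r,r-1 \rangle}(x)$ are the uniquely determined ones with $$f(x) = f^{\langle r,0 \rangle}(x^r)+xf^{\langle r,1 \rangle}(x^r)+ \cdots +x^{r-1}f^{\langle r,r-1 \rangle}(x^r).$$ That is, $f^{\langle r,k\rangle}(x)=\sum_i f_{ri+k}x^i$ if $f(x)=\sum_i f_i x^i$. The operator $U$. For a positive integer $n$ and $0\le k\le r-1$, define $$U_{r,k}^{n}\, h(x) = \left((1+x+\cdots+x^{r-1})^{n} h(x)\right)^{\langle r,k \rangle}.$$ Interlacing. A polynomial is real-rooted if all its zeros are real (nonzero constants are real-rooted). For real-rooted polynomials $f,g$ with positive leading coefficients, write $g\preceq f$ (''$g$ interlaces $f$'') if $\deg f=\deg g$ or $\deg f=\deg g+1$, and the zeros alternate as $\cdots\le v_2\le u_2\le v_1\le u_1$, where the $u_i$ are the zeros of $f$ and the $v_j$ the zeros of $g$, listed with multiplicity in weakly decreasing order. By convention, $a\preceq bx+c$ for any nonnegative reals $a,b,c$, and $0\preceq f$ and $f\preceq 0$ for any real-rooted polynomial $f$ (also $0\preceq 0$). A sequence $(f_1(x),\ldots,f_m(x))$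 of real polynomials, each either zero or with positive leading coefficient, is interlacing if $f_i\preceq f_j$ for all $1\le i<j\le m$. *)

(* Defs.v *)
From mathcomp Require Import all_boot all_order all_algebra.
From mathcomp Require Import reals.
From mathcomp Require Import complex.

Set Implicit Arguments.
Unset Strict Implicit.
Unset Printing Implicit Defensive.

Import Order.TTheory GRing.Theory Num.Theory.
Local Open Scope ring_scope.
Local Open Scope complex_scope.

(* The r-section f^<r,k>.  For 0 < r its coefficients r * i + k with
   i >= size f vanish, so the truncation at size f loses nothing; see
   coef_poly_section and poly_section_decomp. *)
Definition poly_section (R : nzRingType) (r k : nat) (f : {poly R}) : {poly R} :=
  \poly_(i < size f) f`_(r * i + k).

Definition opU (R : nzRingType) (r k n : nat) (h : {poly R}) : {poly R} :=
  poly_section r k ((\sum_(i < r) 'X^i) ^+ n * h).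

Definition cpoly (R : realType) (p : {poly R}) : {poly R[i]} :=
  map_poly (real_complex R) p.

(* The zero polynomial is not real-rooted: every z : R[i] is a zero of it. *)
Definition real_rooted (R : realType) (p : {poly R}) : Prop :=
  forall z : R[i], root (cpoly p) z -> exists x : R, z = x%:C.

(* Same remark: this forces p != 0, and holds for nonzero constants. *)
Definition only_negative_zeros (R : realType) (p : {poly R}) : Prop :=
  forall z : R[i], root (cpoly p) z -> exists2 x : R, x < 0 & z = x%:C.

(* s lists the real zeros of p, with multiplicity, in weakly decreasing order;
   only used for p != 0. *)
Definition zeros_list (R : realType) (p : {poly R}) (s : seq R) : Prop :=
  sorted >=%R s /\ forall x : R, count_mem x s = mup x p.

(* ... <= v_2 <= u_2 <= v_1 <= u_1, with indices shifted to start at 0. *)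
Definition alternate (R : realType) (v u : seq R) : Prop :=
  (forall i, (i < size v)%N -> v`_i <= u`_i) /\
  (forall i, (i.+1 < size u)%N -> u`_i.+1 <= v`_i).

Definition nondegenerate_interlaces (R : realType) (g f : {poly R}) : Prop :=
  [/\ real_rooted g /\ real_rooted f,
      0 < lead_coef g /\ 0 < lead_coef f,
      size f = size g \/ size f = (size g).+1 &
      exists u v : seq R,
        [/\ zeros_list f u, zeros_list g v & alternate v u]].

(* g interlaces f, including the degenerate conventions. *)
Definition interlaces (R : realType) (g f : {poly R}) : Prop :=
  [\/ nondegenerate_interlaces g f,
      exists a b c : R, [/\ 0 <= a, 0 <= b & 0 <= c] /\
        g = a%:P /\ f = b *: 'X + c%:P,
      g = 0 /\ (f = 0 \/ real_rooted f) |
      f = 0 /\ (g = 0 \/ real_rooted g)].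

Definition interlacing_seq (R : realType) (s : seq {poly R}) : Prop :=
  (forall f, f \in s -> f = 0 \/ 0 < lead_coef f) /\
  (forall i j, (i < j < size s)%N -> interlaces s`_i s`_j).

Lemma coef_poly_section (R : nzRingType) (r k i : nat) (f : {poly R}) :
  (0 < r)%N -> (poly_section r k f)`_i = f`_(r * i + k).
Proof.
move=> r0; rewrite coef_poly; case: ltnP => // fi.
by rewrite nth_default // (leq_trans fi) // (leq_trans (leq_pmull i r0)) ?leq_addr.
Qed.

Lemma poly_section_decomp (R : comNzRingType) (r : nat) (f : {poly R}) :
  (0 < r)%N -> f = \sum_(k < r) 'X^k * (poly_section r k f \Po 'X^r).
Proof.
move=> r0; apply/polyP => m; rewrite coef_sum.
have mr : (m %% r < r)%N by rewrite ltn_mod.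
rewrite (bigD1 (Ordinal mr)) //= big1 ?addr0 => [|k kn].
  rewrite coefXnM ltnNge leq_mod /= coef_comp_poly_Xn //.
  have -> : (m - m %% r = m %/ r * r)%N by rewrite {1}(divn_eq m r) addnK.
  by rewrite dvdn_mull // mulnK // coef_poly_section // mulnC -divn_eq.
rewrite coefXnM; case: ltnP => // km; rewrite coef_comp_poly_Xn //.
case: ifP => // rd; case/eqP: kn; apply: val_inj => /=.
by move: rd; rewrite -eqn_mod_dvd // => /eqP ->; rewrite modn_small.
Qed.

(* Main.v *)
Require Import Defs.
From mathcomp Require Import all_boot all_order all_algebra.
From mathcomp Require Import reals.
From mathcomp Require Import complex polyrcf.
From mathcomp Require Import zify ring lra.

(** For real polynomials with positive leading coefficients, [g] interlaces
    [f] as soon as both are real-rooted and [f / g] is a Pick function, that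
    is, [Im (f(z) * conj (g(z))) >= 0] on the open upper half plane.  The
    theorem is proved by checking this inequality for one [z] at a time.

    Fix [z] with [Im z > 0] and let [A m] be the value at [z] of the 0-section
    of [x^m f].  Then [A (m + r) = z * A m], and the [k]-section of [f] has value
    [A (r - k) / z], so all the sections are read off one quasi-periodic
    sequence.  The inequalities wanted are contained in
    [Im (A (m + d) * conj (A m)) >= 0] for [0 <= d <= r]: the numbers [A m] turn
    counterclockwise, by [arg z] in [r] steps ([turning]).
    Multiplying [f] by [x - u] replaces [A m] by [A (m + 1) - u * A m], and
    multiplying by [1 + x + ... + x^(r-1)] replaces it by the window sum
    [A m + ... + A (m + r - 1)].  Expanding by bilinearity, both operations keep
    the sequence turning when [u <= 0] ([turning_shift], [turning_window]),
    because the cases [d = 0] and [d = r] are automatic and the other cross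
    terms only involve index differences between [0] and [r].  Starting from
    [f = 1], this covers [(1 + ... + x^(r-1))^n * h].

    A window sum of a nonzero turning sequence never vanishes, since the window
    lies in a salient cone ([turning_window_neq0]).  Hence for [n > 0] no
    section vanishes off the real line: all the sections are nonzero and
    real-rooted.

    For the alternation of zeros ([pick_interlaces]), let [p] and [q] be the
    multiplicities of a real point [a] in [f] and [g].  Rescaling around [a]
    gives [Im (w^(p-q)) * c >= 0] for all [w] in the upper half plane, [c] being
    the product of the values at [a] of the cofactors of [f] and [g].
    As [Im (w^d)] changes sign for [d > 1], this forces [|p - q| <= 1] and
    determines the sign of [c], which is also given by the parity of the number
    of zeros of [f] and [g] beyond [a].  Sweeping from the right, the excess of
    zeros of [f] over those of [g] can therefore only go from 0 to 1 and back
    ([balanced_above]), which is the alternation. *)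

Set Implicit Arguments.
Unset Strict Implicit.
Unset Printing Implicit Defensive.

Import Order.TTheory GRing.Theory Num.Theory.
Local Open Scope ring_scope.

(** * The cross product and turning sequences *)

Section Cross.
Variable R : rcfType.
Implicit Types (a b c z w : R[i]) (A : nat -> R[i]) (m d r : nat).

Definition cross a b : R := complex.Im (a * conjc b).

Lemma crossE a b : cross a b =
  complex.Im a * complex.Re b - complex.Re a * complex.Im b.
Proof. by case: a => x y; case: b => u v; rewrite /cross /=; ring. Qed.

Definition sqnorm a : R := complex.Re a ^+ 2 + complex.Im a ^+ 2.

Lemma sqnorm_gt0 a : a != 0 -> 0 < sqnorm a.
Proof.
case: a => x y; rewrite eq_complex /= negb_and /sqnorm /= => xy.
rewrite lt0r addr_ge0 ?sqr_ge0 // andbT paddr_eq0 ?sqr_ge0 //.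
by rewrite !sqrf_eq0 negb_and.
Qed.

Lemma sqnorm_ge0 a : 0 <= sqnorm a.
Proof. by rewrite addr_ge0 ?sqr_ge0. Qed.

Lemma crossDl a b c : cross (a + b) c = cross a c + cross b c.
Proof. by case: a => ? ?; case: b => ? ?; rewrite !crossE /=; ring. Qed.

Lemma crossDr a b c : cross c (a + b) = cross c a + cross c b.
Proof. by case: a => ? ?; case: b => ? ?; rewrite !crossE /=; ring. Qed.

Lemma crossNl a b : cross (- a) b = - cross a b.
Proof. by case: a => ? ?; rewrite !crossE /=; ring. Qed.

Lemma cross0l a : cross 0 a = 0.
Proof. by rewrite crossE /=; ring. Qed.

Lemma cross0r a : cross a 0 = 0.
Proof. by rewrite crossE /=; ring. Qed.

Lemma crossC a b : cross a b = - cross b a.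
Proof. by rewrite !crossE; ring. Qed.

Lemma crossaa a : cross a a = 0.
Proof. by rewrite crossE; ring. Qed.

Lemma crossZr (t : R) a b : cross a (t%:C%C * b) = t * cross a b.
Proof. by case: b => ? ?; rewrite !crossE /=; ring. Qed.

Lemma crossZl (t : R) a b : cross (t%:C%C * a) b = t * cross a b.
Proof. by case: a => ? ?; rewrite !crossE /=; ring. Qed.

Lemma crossMM z a b : cross (z * a) (z * b) = sqnorm z * cross a b.
Proof.
by case: z => ? ?; case: a => ? ?; case: b => ? ?; rewrite !crossE /sqnorm /=; ring.
Qed.

Lemma cross_mulr z a : cross (z * a) a = complex.Im z * sqnorm a.
Proof. by case: z => ? ?; case: a => ? ?; rewrite crossE /sqnorm /=; ring. Qed.

Lemma cross_suml (I : Type) (s : seq I) (P : pred I) (F : I -> R[i]) b :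
  cross (\sum_(i <- s | P i) F i) b = \sum_(i <- s | P i) cross (F i) b.
Proof. by apply: (big_morph (cross^~ b)) => [x y|]; rewrite ?crossDl ?cross0l. Qed.

Lemma cross_sumr (I : Type) (s : seq I) (P : pred I) (F : I -> R[i]) b :
  cross b (\sum_(i <- s | P i) F i) = \sum_(i <- s | P i) cross b (F i).
Proof. by apply: (big_morph (cross b)) => [x y|]; rewrite ?crossDr ?cross0r. Qed.

(** The second clause says that [A (m + d)] is at an angle between 0 and [pi]
    counterclockwise from [A m]; zero values are allowed. *)
Definition turning z r A :=
  (forall m, A (m + r)%N = z * A m) /\
  (forall m d, (d <= r)%N -> 0 <= cross (A (m + d)%N) (A m)).

(** For [d = 0] the cross product is that of a number with itself, and for
    [d = r] it is [Im z * |A m|^2]. *)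
Lemma turning_interior z r A : 0 < complex.Im z ->
  (forall m, A (m + r)%N = z * A m) ->
  (forall m d, (0 < d < r)%N -> 0 <= cross (A (m + d)%N) (A m)) ->
  turning z r A.
Proof.
move=> z0 Ar Aint; split=> // m [|d] dr; first by rewrite addn0 crossaa.
move: dr; rewrite leq_eqVlt => /orP[/eqP->|dr]; last exact: Aint.
by rewrite Ar cross_mulr mulr_ge0 ?sqnorm_ge0 // ltW.
Qed.

Lemma eq_turning z r A B : A =1 B -> turning z r A -> turning z r B.
Proof.
by move=> AB [Ar At]; split=> [m|m d dr]; rewrite -!AB ?Ar ?At.
Qed.

Lemma turning_scale z r A (t : R) : turning z r A ->
  turning z r (fun m => t%:C%C * A m).
Proof.
case=> Ar At; split=> [m|m d dr]; first by rewrite Ar mulrCA.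
by rewrite crossZl crossZr mulrA mulr_ge0 ?At // -expr2 sqr_ge0.
Qed.

(** The cross product of two new terms expands into four old ones, with index
    differences [d], [d], [d + 1] and [d - 1]; these stay within [0, r] once
    [0 < d < r]. *)
Lemma turning_shift z r A (t : R) : 0 < complex.Im z -> 0 <= t ->
  turning z r A -> turning z r (fun m => A m.+1 + t%:C%C * A m).
Proof.
move=> z0 t0 [Ar At]; apply: turning_interior => // [m|m d /andP[d0 dr]].
  by rewrite -addSn !Ar; ring.
rewrite !(crossDl, crossDr, crossZl, crossZr) -addSn.
have At' k l : (k <= l <= k + r)%N -> 0 <= cross (A l) (A k).
  by move=> /andP[kl lk]; rewrite -(subnKC kl) At //; lia.
by rewrite !(addr_ge0, mulr_ge0) // At' //; lia.
Qed.

(** Two windows at distance [d < r] are [P + Q] and [Q + z * P], where [P] sums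
    the first [d] terms and [Q] is the common part.  Of the four cross products,
    [Q] with itself contributes 0, [z * P] with [P] contributes
    [Im z * |P|^2], and the other two have index differences within [0, r]. *)
Lemma turning_window z r A : 0 < complex.Im z ->
  turning z r A -> turning z r (fun m => \sum_(j < r) A (m + j)%N).
Proof.
move=> z0 [Ar At]; apply: turning_interior => // [m|m d /andP[d0 dr]].
  by rewrite mulr_sumr; apply: eq_bigr => j _; rewrite -Ar; congr A; lia.
have At' k l : (k <= l <= k + r)%N -> 0 <= cross (A l) (A k).
  by move=> /andP[kl lk]; rewrite -(subnKC kl) At //; lia.
set P := \sum_(0 <= j < d) A (m + j)%N.
set Q := \sum_(d <= j < r) A (m + j)%N.
have -> : \sum_(j < r) A (m + j)%N = P + Q.
  by rewrite -(big_mkord xpredT (fun j => A (m + j)%N)) (@big_cat_nat _ _ _ d) //= ltnW.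
have -> : \sum_(j < r) A (m + d + j)%N = Q + z * P.
  rewrite -(big_mkord xpredT (fun j => A (m + d + j)%N)).
  rewrite (@big_cat_nat _ _ _ (r - d)) ?leq_subr //=; congr (_ + _).
    rewrite /Q -[X in index_iota X r]add0n big_addn; apply: eq_bigr => j _.
    by congr A; lia.
  rewrite -[X in index_iota X r]add0n big_addn subKn; last exact: ltnW.
  by rewrite mulr_sumr; apply: eq_bigr => j _; rewrite -Ar; congr A; lia.
rewrite crossDl !crossDr crossaa addr0 cross_mulr !addr_ge0 //.
- rewrite cross_suml big_nat_cond sumr_ge0 // => i /andP[/andP[di ir] _].
  rewrite cross_sumr big_nat_cond sumr_ge0 // => j /andP[/andP[_ jd] _].
  by apply: At'; lia.
- by rewrite mulr_ge0 ?sqnorm_ge0 // ltW.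
- rewrite mulr_sumr cross_suml big_nat_cond sumr_ge0 // => i /andP[/andP[_ id] _].
  rewrite cross_sumr big_nat_cond sumr_ge0 // => j /andP[/andP[dj jr] _].
  by rewrite -Ar; apply: At'; lia.
Qed.

(** Let [A (m + i)] be the first nonzero term of the window.  Every
    term lies in the closed half plane clockwise from
    [z * A (m + i) = A (m + i + r)], and [A (m + i)] itself lies in its interior;
    hence the sum is not 0. *)
Lemma turning_window_neq0 z r A m : 0 < complex.Im z -> (0 < r)%N ->
  turning z r A -> (exists k, A k != 0) -> \sum_(j < r) A (m + j)%N != 0.
Proof.
move=> z0 r0 [Ar At] [k Ak]; apply/eqP => S0.
have nz : z != 0 by apply: contraTneq z0 => ->; rewrite /= ltxx.
have iterr t l : A (l + t * r)%N = z ^+ t * A l.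
  elim: t => [|t IH]; first by rewrite mul0n addn0 expr0 mul1r.
  by rewrite mulSnr addnA Ar IH exprS mulrA.
(* If the window vanished, quasi-periodicity would propagate 0 both upwards and
   downwards to every index. *)
have [j Aj] : exists j : 'I_r, A (m + j)%N != 0.
  have l0 : ((k + m * r - m) %% r < r)%N by rewrite ltn_mod.
  have ge : (m <= k + m * r)%N by nia.
  exists (Ordinal l0) => /=; apply: contra_neq Ak => A0.
  have := iterr m k; have := iterr ((k + m * r - m) %/ r)%N (m + (k + m * r - m) %% r)%N.
  rewrite A0 mulr0 -addnA [(_ %% _ + _)%N]addnC -divn_eq subnKC // => -> /esym/eqP.
  by rewrite mulf_eq0 expf_eq0 (negPf nz) andbF /= => /eqP.
have : exists j, (A (m + j)%N != 0) by exists j.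
case/ex_minnP => i Ai imin.
have ir : (i < r)%N by apply: leq_ltn_trans (imin _ Aj) _.
have : 0 < cross (z * A (m + i)%N) (\sum_(j < r) A (m + j)%N).
  rewrite cross_sumr (bigD1 (Ordinal ir)) //= cross_mulr.
  rewrite ltr_pwDl ?mulr_gt0 ?sqnorm_gt0 // sumr_ge0 // => l _.
  have [li|il] := ltnP l i.
    case: (eqVneq (A (m + l)%N) 0) => [->|/imin]; first by rewrite cross0r.
    by rewrite leqNgt li.
  rewrite -Ar (_ : (m + i + r = m + l + (i + r - l))%N); last by have := ltn_ord l; lia.
  by apply: At; have := ltn_ord l; lia.
by rewrite S0 cross0r ltxx.
Qed.

(** If the new sequence vanished, [A] would be geometric of ratio [- t], so
    that [z = (- t)^r] would be real. *)
Lemma turning_shift_neq0 z r A (t : R) : 0 < complex.Im z ->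
  turning z r A -> (exists k, A k != 0) ->
  exists k, A k.+1 + t%:C%C * A k != 0.
Proof.
move=> z0 [Ar At] [k Ak].
have [/existsP[j Bj]|/existsPn B0] :=
    boolP [exists j : 'I_r, A (k + j).+1 + t%:C%C * A (k + j)%N != 0].
  by exists (k + j)%N.
have geo j : (j <= r)%N -> A (k + j)%N = (- t)%:C%C ^+ j * A k.
  elim: j => [|j IH] jr; first by rewrite addn0 expr0 mul1r.
  have /= := B0 (Ordinal jr); rewrite negbK addr_eq0 addnS => /eqP->.
  by rewrite IH ?(ltnW jr) // exprS rmorphN; ring.
have /eqP := geo r (leqnn r); rewrite Ar -subr_eq0 -mulrBl mulf_eq0 (negPf Ak) orbF.
rewrite subr_eq0 -rmorphXn /= => /eqP zE.
by move: z0; rewrite zE /= ltxx.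
Qed.
End Cross.

(** * Sections as values of a turning sequence *)

Section PolySection.
Variable R : nzRingType.
Implicit Types (f g : {poly R}) (t : R) (r k : nat).

Lemma poly_sectionD r k f g : (0 < r)%N ->
  poly_section r k (f + g) = poly_section r k f + poly_section r k g.
Proof. by move=> r0; apply/polyP => i; rewrite coefD !coef_poly_section // coefD. Qed.

Lemma poly_sectionZ r k t f : (0 < r)%N ->
  poly_section r k (t *: f) = t *: poly_section r k f.
Proof. by move=> r0; apply/polyP => i; rewrite coefZ !coef_poly_section // coefZ. Qed.

Lemma poly_section_Xn r k f : (k < r)%N ->
  poly_section r 0 ('X^(r - k) * f) = 'X * poly_section r k f.
Proof.
move=> kr; have r0 : (0 < r)%N by lia.
apply/polyP => i; rewrite coefXM coef_poly_section // coefXnM addn0.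
case: i => [|i] /=; first by rewrite muln0 subn_gt0 kr.
rewrite coef_poly_section // ifF; first by congr (_ `_ _); nia.
by apply/negbTE; rewrite -leqNgt; nia.
Qed.

End PolySection.

Section Sections.
Variable R : realType.
Implicit Types (f g : {poly R}) (z : R[i]) (m r k : nat).

Lemma cpolyD f g : cpoly (f + g) = cpoly f + cpoly g.
Proof. exact: rmorphD. Qed.

Lemma cpolyM f g : cpoly (f * g) = cpoly f * cpoly g.
Proof. exact: rmorphM. Qed.

Lemma cpoly_horner_real f (x : R) : (cpoly f).[x%:C%C] = (f.[x])%:C%C.
Proof. exact: horner_map. Qed.

(** The orientation of the indices is chosen so that multiplying [f] by [x] is
    the shift [m -> m + 1]. *)
Definition section_values r z f m : R[i] :=
  (cpoly (poly_section r 0 ('X^m * f))).[z].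

Lemma section_values_rev r z f k : (k < r)%N ->
  section_values r z f (r - k) = z * (cpoly (poly_section r k f)).[z].
Proof.
move=> kr; rewrite /section_values poly_section_Xn //.
by rewrite cpolyM hornerM /cpoly map_polyX hornerX.
Qed.

Lemma section_values_period r z f m : (0 < r)%N ->
  section_values r z f (m + r) = z * section_values r z f m.
Proof.
move=> r0; rewrite /section_values addnC exprD -mulrA.
by rewrite -{2}[r]subn0 poly_section_Xn // cpolyM hornerM /cpoly map_polyX hornerX.
Qed.

Lemma section_valuesD r z f g m : (0 < r)%N ->
  section_values r z (f + g) m = section_values r z f m + section_values r z g m.
Proof. by move=> r0; rewrite /section_values mulrDr poly_sectionD // cpolyD hornerD. Qed.

Lemma section_valuesZ r z (t : R) f m : (0 < r)%N ->
  section_values r z (t *: f) m = t%:C%C * section_values r z f m.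
Proof.
move=> r0; rewrite /section_values -scalerAr poly_sectionZ //.
by rewrite /cpoly linearZ /= hornerZ.
Qed.

Lemma section_values0 r z m : (0 < r)%N -> section_values r z 0 m = 0.
Proof. by move=> r0; rewrite -[0 in LHS](scale0r 0) section_valuesZ // mul0r. Qed.

Lemma section_valuesXn r z f m j :
  section_values r z ('X^j * f) m = section_values r z f (m + j).
Proof. by rewrite /section_values mulrA -exprD. Qed.

Lemma section_values_window r z f m : (0 < r)%N ->
  section_values r z ((\sum_(i < r) 'X^i) * f) m =
  \sum_(j < r) section_values r z f (m + j).
Proof.
move=> r0; rewrite mulr_suml.
rewrite (big_morph (fun p => section_values r z p m) (id1 := 0) (op1 := +%R)).
- by apply: eq_bigr => j _; rewrite section_valuesXn.
- by move=> p q; rewrite section_valuesD.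
- exact: section_values0.
Qed.

Lemma section_values_linear r z f (u : R) m : (0 < r)%N ->
  section_values r z (('X - u%:P) * f) m =
  section_values r z f m.+1 + (- u)%:C%C * section_values r z f m.
Proof.
move=> r0; rewrite mulrBl mul_polyC -scaleNr section_valuesD // section_valuesZ //.
by rewrite -['X in LHS]expr1 section_valuesXn addn1.
Qed.

Lemma section_values1 r z m : (0 < r)%N ->
  section_values r z 1 m = if (r %| m)%N then z ^+ (m %/ r) else 0.
Proof.
move=> r0; rewrite /section_values mulr1.
have -> : poly_section r 0 'X^m = if (r %| m)%N then 'X^(m %/ r) else 0 :> {poly R}.
  apply/polyP => i; rewrite coef_poly_section // coefXn addn0.
  case: ifP => [/dvdnP[q ->]|ndv].
    by rewrite coefXn mulnK // mulnC eqn_pmul2r.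
  by rewrite coef0; case: eqP => // E; rewrite -E dvdn_mulr in ndv.
case: ifP => _; first by rewrite /cpoly map_polyXn hornerXn.
by rewrite /cpoly rmorph0 horner0.
Qed.

(** The second clause is propagated along with the first because it is what
    makes the window sums nonzero in the end. *)
Definition sections_turn r z f :=
  turning z r (section_values r z f) /\ exists m, section_values r z f m != 0.

Lemma sections_turn1 r z : (0 < r)%N -> 0 < complex.Im z -> sections_turn r z 1.
Proof.
move=> r0 z0; split; last first.
  by exists 0%N; rewrite section_values1 // dvdn0 div0n expr0 oner_eq0.
apply: turning_interior => // [m|m d /andP[d0 dr]]; first exact: section_values_period.
rewrite !section_values1 //; have [dm|_] := boolP (r %| m)%N; last by rewrite cross0r.
by rewrite dvdn_addr // gtnNdvd // cross0l.
Qed.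

Lemma sections_turnZ r z f (t : R) : (0 < r)%N -> t != 0 ->
  sections_turn r z f -> sections_turn r z (t *: f).
Proof.
move=> r0 t0 [ft [m fm]]; split.
  apply: eq_turning (turning_scale t ft) => k; by rewrite section_valuesZ.
by exists m; rewrite section_valuesZ // mulf_neq0 // fmorph_eq0.
Qed.

Lemma sections_turn_linear r z f (u : R) : (0 < r)%N -> 0 < complex.Im z -> u <= 0 ->
  sections_turn r z f -> sections_turn r z (('X - u%:P) * f).
Proof.
move=> r0 z0 u0 [ft fm]; split.
  have u0' : 0 <= - u by rewrite oppr_ge0.
  by apply: eq_turning (turning_shift z0 u0' ft) => k; rewrite section_values_linear.
by have [m Am] := turning_shift_neq0 (- u) z0 ft fm; exists m; rewrite section_values_linear.
Qed.

Lemma sections_turn_window r z f : (0 < r)%N -> 0 < complex.Im z ->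
  sections_turn r z f -> sections_turn r z ((\sum_(i < r) 'X^i) * f).
Proof.
move=> r0 z0 [ft fm]; split.
  by apply: eq_turning (turning_window z0 ft) => k; rewrite section_values_window.
by exists 0%N; rewrite section_values_window // (turning_window_neq0 _ z0).
Qed.

Lemma sections_turn_opU r z n h (t : R) (s : seq R) :
  (0 < r)%N -> 0 < complex.Im z -> t != 0 -> (forall u, u \in s -> u <= 0) ->
  h = t *: \prod_(u <- s) ('X - u%:P) ->
  sections_turn r z ((\sum_(i < r) 'X^i) ^+ n * h).
Proof.
move=> r0 z0 t0 s0 ->; elim: n => [|n IH]; last first.
  by rewrite exprS -mulrA; apply: sections_turn_window.
rewrite mul1r; apply: sections_turnZ => //.
elim: s s0 => [|u s IH] s0; first by rewrite big_nil; exact: sections_turn1.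
rewrite big_cons; apply: sections_turn_linear => //; first by apply: s0; rewrite mem_head.
by apply: IH => v vs; apply: s0; rewrite inE vs orbT.
Qed.

Lemma root_conj f z : root (cpoly f) z -> root (cpoly f) (conjc z).
Proof.
rewrite /root -(conjc_eq0 (cpoly f).[z]) -horner_map /= /cpoly -map_poly_comp /=.
rewrite (_ : map_poly _ f = map_poly (real_complex R) f) //.
by apply: eq_map_poly => x /=; rewrite oppr0.
Qed.

(** The zeros of a real polynomial come in conjugate pairs. *)
Lemma nonvanishing_real_rooted f :
  (forall z, 0 < complex.Im z -> (cpoly f).[z] != 0) -> real_rooted f.
Proof.
move=> fz [x y] rz; exists x; case: (ltgtP y 0) => [y0|y0|->] //.
  have /fz : 0 < complex.Im (conjc (x +i* y)%C) by rewrite /= oppr_gt0.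
  by rewrite -/(root _ _) => /negP[]; apply: root_conj.
by have /fz/negP[] : 0 < complex.Im (x +i* y)%C.
Qed.

(** The predicate [P] keeps track of the location of the zeros: it is instantiated
    with negativity for [h] and with [True] for the sections. *)
Lemma split_roots (P : R -> Prop) f : f != 0 ->
  (forall z, root (cpoly f) z -> exists2 x, P x & z = x%:C%C) ->
  exists2 s : seq R, (forall x, x \in s -> P x) &
    f = lead_coef f *: \prod_(x <- s) ('X - x%:P).
Proof.
move: {2}(size f) (leqnn (size f)) => n; elim: n f => [|n IH] f fn f0 fP.
  by move: fn; rewrite leqn0 size_poly_eq0 (negPf f0).
have [f1|f1] := eqVneq (size f) 1%N.
  exists [::] => //; rewrite big_nil -mul_polyC mulr1.
  by rewrite {1}(size1_polyC (eq_leq f1)) lead_coefE f1.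
have : size (cpoly f) != 1%N by rewrite /cpoly size_map_poly.
case/closed_rootP => z fz; have [x Px zx] := fP _ fz.
move: fz; rewrite zx /root cpoly_horner_real fmorph_eq0 => /factor_theorem[q fq].
have q0 : q != 0 by apply: contraNneq f0 => q0; rewrite fq q0 mul0r.
have [|w wq|s sP qs] := IH q _ q0.
- by move: fn; rewrite fq size_Mmonic ?monicXsubC // size_XsubC addn2 ltnS.
- by apply: fP; rewrite fq cpolyM rootM wq.
exists (x :: s) => [y|].
  by rewrite inE => /predU1P[->|/sP].
by rewrite {1}fq {1}qs fq lead_coefM lead_coefXsubC mulr1 big_cons -scalerAl mulrC.
Qed.
End Sections.

(** * Alternation of lists from local parities *)

Section Lists.
Context {disp : Order.disp_t} {T : orderType disp}.
Implicit Types (u v : seq T) (a : T).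

Local Notation above u a := (count (fun x => (a < x)%O) u).
Local Notation atleast u a := (count (fun x => (a <= x)%O) u).

Lemma atleast_split u a : atleast u a = (above u a + count_mem a u)%N.
Proof.
elim: u => //= x u ->; rewrite [(a <= x)%O]le_eqVlt eq_sym.
by case: eqVneq => [->|_]; rewrite ?ltxx /=; case: (a < x)%O; lia.
Qed.

Lemma seq_min (x0 : T) u : x0 \in u ->
  exists2 b, b \in u & forall x, x \in u -> (b <= x)%O.
Proof.
elim: u x0 => // x u IH _ _; case: u IH => [|y u] IH.
  by exists x; rewrite ?mem_head // => y; rewrite inE => /eqP->.
have [b bu bmin] := IH y (mem_head _ _).
have [xb|bx] := leP x b.
  exists x; rewrite ?mem_head // => w; rewrite inE => /predU1P[->//|/bmin].
  exact: le_trans.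
exists b; first by rewrite inE bu orbT.
by move=> w; rewrite inE => /predU1P[->|/bmin//]; apply: ltW.
Qed.

(** What the Pick property of [f / g] says at the point [a] about the zero lists
    [u] of [f] and [v] of [g]. *)
Definition local_alternation u v a : Prop :=
  [\/ count_mem a u = count_mem a v,
      count_mem a u = (count_mem a v).+1 /\ ~~ odd (above u a + above v a) |
      count_mem a v = (count_mem a u).+1 /\ odd (above u a + above v a)].

Definition balanced (p q : nat) : bool := (q <= p <= q.+1)%N.

(** Induction on the number of entries beyond [a]: the counts strictly beyond [a]
    are the counts up to and including the nearest such entry [b], where
    [local_alternation] allows the excess to grow only from an even total, i.e.
    from 0, and to shrink only from an odd one, i.e. from 1. *)
Lemma balanced_above u v a : (forall b, local_alternation u v b) ->
  balanced (above u a) (above v a).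
Proof.
move=> loc; move: {2}(size _) (leqnn (size [seq x <- u ++ v | (a < x)%O])) => n.
elim: n a => [|n IH] a.
  rewrite size_filter count_cat leqn0 addn_eq0 => /andP[/eqP-> /eqP->] //.
set s := [seq x <- u ++ v | (a < x)%O] => sn.
case: (eqVneq s [::]) => [s0|].
  have : size s = 0%N by rewrite s0.
  by rewrite size_filter count_cat => /eqP; rewrite addn_eq0 => /andP[/eqP-> /eqP->].
case sE : s => [|x0 s'] // _.
have [b bs bmin] : exists2 b, b \in s & forall x, x \in s -> (b <= x)%O.
  by apply: (@seq_min x0); rewrite sE mem_head.
have ab : (a < b)%O by move: bs; rewrite mem_filter => /andP[].
have aboveE w : {subset w <= u ++ v} -> above w a = atleast w b.
  move=> wuv; apply: eq_in_count => x xw; apply/idP/idP => [ax|]; last exact: lt_le_trans.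
  by apply: bmin; rewrite mem_filter ax wuv.
have /IH : (size [seq x <- u ++ v | (b < x)%O] <= n)%N.
  rewrite -ltnS (leq_trans _ sn) // !size_filter.
  rewrite aboveE // atleast_split -[X in (X < _)%N]addn0 ltn_add2l -has_count.
  by rewrite has_pred1; move: bs; rewrite mem_filter => /andP[].
rewrite !aboveE; try by move=> x xw; rewrite mem_cat xw ?orbT.
rewrite !atleast_split /balanced.
by case: (loc b) => [->|[-> ]|[-> ]]; lia.
Qed.

Lemma balanced_atleast u v a : (forall b, local_alternation u v b) ->
  balanced (atleast u a) (atleast v a).
Proof.
move=> loc; have := balanced_above a loc; rewrite !atleast_split /balanced.
by case: (loc a) => [->|[-> ]|[-> ]]; lia.
Qed.

Lemma balanced_size u v : (forall b, local_alternation u v b) ->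
  balanced (size u) (size v).
Proof.
move=> loc; case uvE : (u ++ v) => [|x0 s].
  by move: (congr1 size uvE); rewrite size_cat; case: u v {uvE loc} => [|? ?] [].
have [b bmin] : exists b, forall x, x \in u ++ v -> (b <= x)%O.
  have [|b _ bmin] := @seq_min x0 (u ++ v); first by rewrite uvE mem_head.
  by exists b.
have allE w : {subset w <= u ++ v} -> size w = atleast w b.
  move=> wuv; apply/esym/eqP; rewrite -all_count; apply/allP => x /wuv; exact: bmin.
rewrite (allE u) ?(allE v); first exact: balanced_atleast.
  by move=> x xw; rewrite mem_cat xw orbT.
by move=> x xw; rewrite mem_cat xw.
Qed.

(** This lemma and the next translate between entries of a decreasing list and
    counts: the entry of index [i] is at least [a] iff more than [i] entries
    are. *)
Lemma nth_atleast x0 u a i : sorted >=%O u -> (i < atleast u a)%N ->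
  (a <= nth x0 u i)%O.
Proof.
elim: u i => [|x u IH] i //= xu; have srt := path_sorted xu.
case: i => [|i] /=.
  case: (boolP (a <= x)%O) => //= ax; rewrite -has_count => /hasP[y yu ay].
  have /allP/(_ _ yu) /= yx := order_path_min (@ge_trans _ T) xu.
  by rewrite (le_trans ay yx) in ax.
by move=> lt; apply: IH => //; move: lt; case: (a <= x)%O; rewrite ?add0n // => /ltnW.
Qed.

Lemma atleast_nth x0 u i : sorted >=%O u -> (i < size u)%N ->
  (i < atleast u (nth x0 u i))%N.
Proof.
elim: u i => [|x u IH] [|i] //= xu iu; first by rewrite lexx.
have /allP/(_ (nth x0 u i)) /= yx := order_path_min (@ge_trans _ T) xu.
by rewrite yx ?mem_nth // add1n ltnS IH // (path_sorted xu).
Qed.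
End Lists.

(** * From the Pick property to interlacing *)

Section Local.
Variable R : realType.
Implicit Types (f g F G : {poly R}) (a : R) (u v : seq R).

Lemma horner_real_imag (P : {poly R[i]}) : exists Pr Pi : {poly R},
  forall t : R, P.[t%:C%C] = (Pr.[t] +i* Pi.[t])%C.
Proof.
elim/poly_ind: P => [|P [x y] [Pr [Pi PE]]].
  by exists 0, 0 => t; rewrite !horner0.
exists (Pr * 'X + x%:P), (Pi * 'X + y%:P) => t.
by rewrite !hornerE PE /=; congr (_ +i* _)%C; ring.
Qed.

(** Along the real line the cross product is a real polynomial in [t], hence
    continuous at 0. *)
Lemma cross_limit0 (P Q : {poly R[i]}) :
  (forall t : R, 0 < t -> 0 <= cross P.[t%:C%C] Q.[t%:C%C]) ->
  0 <= cross P.[0] Q.[0].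
Proof.
have [Pr [Pi PE]] := horner_real_imag P; have [Qr [Qi QE]] := horner_real_imag Q.
pose q := Pi * Qr - Pr * Qi.
have qE t : cross P.[t%:C%C] Q.[t%:C%C] = q.[t] by rewrite PE QE crossE /= !hornerE.
move=> q0; rewrite -(rmorph0 (real_complex R)) qE.
rewrite leNgt; apply/negP => qn; have nq : 0 < - q.[0] by rewrite oppr_gt0.
have [d d0 dq] := poly_cont 0 q nq.
have d2 : 0 < d / 2 by lra.
have := dq (d / 2); rewrite subr0 gtr0_norm // ltr_pdivrMr // ltr_pMr // ltr1n => /(_ isT).
have := q0 _ d2; rewrite qE => qd.
by rewrite ltr_norml => /andP[]; lra.
Qed.

(** For [d > 1] the upper half plane contains a [d]-th root of [- i c], which
    makes the product equal to [- c^2]. *)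
Lemma Im_exp_sign (c : R) d : c != 0 ->
  (forall w : R[i], 0 < complex.Im w -> 0 <= c * complex.Im (w ^+ d)) ->
  d = 0%N \/ d = 1%N /\ 0 < c.
Proof.
case: d => [|[|d]] c0 cw; first by left.
  right; split=> //; rewrite lt0r c0 /=.
  by have := cw (0 +i* 1)%C; rewrite expr1 /= mulr1; apply.
exfalso; pose w : R[i] := (d.+2).-root (0 +i* (- c))%C.
have wE : w ^+ d.+2 = (0 +i* (- c))%C by rewrite rootCK.
have w0 : 0 <= complex.Im w.
  have : 0 <= 'Im w by apply: Im_rootC_ge0.
  by rewrite -complexIm /=; simpc.
have wn : complex.Im w != 0.
  apply: contraNneq c0 => w1.
  have := wE; rewrite [w]complexE w1 mulr0 addr0 -rmorphXn /= => -[_ /eqP].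
  by rewrite eq_sym oppr_eq0.
have := cw w; rewrite lt0r wn w0 wE /= => /(_ isT).
have : 0 < c ^+ 2 by rewrite lt0r sqrf_eq0 c0 sqr_ge0.
nra.
Qed.

(** Put [z = a + t * w] with [t > 0]: the factor [t^d] drops out, and letting [t]
    go to 0 leaves [F.[a] * G.[a] * Im (w^d) >= 0]. *)
Lemma order_sign F G a d : F.[a] != 0 -> G.[a] != 0 ->
  (forall z : R[i], 0 < complex.Im z ->
     0 <= cross ((z - a%:C%C) ^+ d * (cpoly F).[z]) (cpoly G).[z]) ->
  d = 0%N \/ d = 1%N /\ 0 < F.[a] * G.[a].
Proof.
move=> Fa Ga FG; apply: Im_exp_sign; first by rewrite mulf_neq0.
move=> w w0.
pose l := a%:C%C%:P + w *: 'X : {poly R[i]}.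
have lE (t : R[i]) : l.[t] = a%:C%C + w * t by rewrite /l !hornerE.
have := @cross_limit0 ((w ^+ d) *: (cpoly F \Po l)) (cpoly G \Po l).
rewrite !hornerZ !horner_comp !lE mulr0 addr0 !cpoly_horner_real.
have -> : cross (w ^+ d * (F.[a])%:C%C) (G.[a])%:C%C =
    F.[a] * G.[a] * complex.Im (w ^+ d).
  by rewrite mulrC crossZl -[X in cross _ X]mulr1 crossZr crossE /=; ring.
apply=> t t0; rewrite !hornerZ !horner_comp !lE.
have /FG : 0 < complex.Im (a%:C%C + w * t%:C%C).
  by case: (w) w0 => x y /= y0; rewrite add0r mulr0 add0r mulr_gt0.
rewrite [a%:C%C + _]addrC addrK exprMn [w ^+ d * _]mulrC -mulrA -rmorphXn /= crossZl.
by rewrite pmulr_rge0 ?exprn_gt0.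
Qed.

Definition from_roots (t : R) u : {poly R} := t *: \prod_(x <- u) ('X - x%:P).

(** The factor [a - x] is negative exactly for the roots [x] beyond [a]. *)
Lemma from_roots_split t u a : 0 < t -> exists2 F,
  from_roots t u = ('X - a%:P) ^+ count_mem a u * F &
  0 < (-1) ^+ count (fun x => a < x) u * F.[a].
Proof.
move=> t0; elim: u => [|x u [F FE Fa]].
  exists t%:P; first by rewrite /from_roots big_nil mul1r -mul_polyC mulr1.
  by rewrite /= hornerC mul1r.
have fE : from_roots t (x :: u) = ('X - x%:P) * from_roots t u.
  by rewrite /from_roots big_cons scalerAr.
rewrite fE FE /=; case: eqVneq => [->|xa].
  by exists F; rewrite ?ltxx ?add0n // add1n exprS mulrA.
exists (('X - x%:P) * F); first by rewrite add0n mulrCA.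
rewrite hornerM hornerXsubC; have [ax|xa'] := ltrP a x.
  rewrite add1n exprS -mulrA mulN1r mulrCA -mulNr mulr_gt0 //; lra.
rewrite add0n mulrCA mulr_gt0 //; move: xa xa'; rewrite le_eqVlt eq_sym => /negPf->.
by rewrite subr_gt0.
Qed.

(** Dividing by [|z - a|^(2 * min(p, q))] leaves a power of [z - a] on one side
    only, to which [order_sign] applies. *)
Lemma pick_local_alternation t1 t2 u v a : 0 < t1 -> 0 < t2 ->
  (forall z : R[i], 0 < complex.Im z ->
     0 <= cross (cpoly (from_roots t1 u)).[z] (cpoly (from_roots t2 v)).[z]) ->
  local_alternation u v a.
Proof.
move=> t10 t20.
have [F -> Fa] := from_roots_split u a t10.
have [G -> Ga] := from_roots_split v a t20.
set p := count_mem a u; set q := count_mem a v => pick.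
set k := count _ u in Fa; set l := count _ v in Ga.
have F0 : F.[a] != 0 by apply: contraTneq Fa => ->; rewrite mulr0 ltxx.
have G0 : G.[a] != 0 by apply: contraTneq Ga => ->; rewrite mulr0 ltxx.
have FG : 0 < (-1) ^+ (k + l) * (F.[a] * G.[a]).
  by rewrite exprD mulrACA mulr_gt0.
have linE m (H : {poly R}) (z : R[i]) :
    (cpoly (('X - a%:P) ^+ m * H)).[z] = (z - a%:C%C) ^+ m * (cpoly H).[z].
  rewrite cpolyM hornerM /cpoly rmorphXn /= horner_exp rmorphB /= map_polyX map_polyC /=.
  by rewrite hornerXsubC.
have sqn_gt0 m (z : R[i]) : 0 < complex.Im z -> 0 < sqnorm ((z - a%:C%C) ^+ m).
  move=> z0; rewrite sqnorm_gt0 // expf_neq0 // subr_eq0.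
  by apply: contraTneq z0 => ->; rewrite /= ltxx.
have [qp|pq] := leqP q p.
  have [|d0|[d1 c0]] := @order_sign F G a (p - q) F0 G0.
  - move=> z z0; have := pick z z0; rewrite !linE -{1}(subnKC qp) exprD -mulrA.
    by rewrite crossMM pmulr_rge0 ?sqn_gt0.
  - by apply: Or31; rewrite -/p -/q; lia.
  - apply: Or32; rewrite -/p -/q -/k -/l; split; first lia.
    by move: FG; rewrite -signr_odd pmulr_lgt0 //; case: odd => //=; rewrite ltr0N1.
(* Swapping the two arguments changes the sign of the cross product, which is
   absorbed into [G]. *)
have G0' : (- G).[a] != 0 by rewrite hornerN oppr_eq0.
have [|d0|[d1 c0]] := @order_sign (- G) F a (q - p) G0' F0.
- move=> z z0; have := pick z z0; rewrite !linE -{1}(subnKC (ltnW pq)) exprD -mulrA.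
  rewrite crossMM pmulr_rge0 ?sqn_gt0 // crossC.
  by rewrite /cpoly rmorphN hornerN mulrN crossNl.
- by lia.
- apply: Or33; rewrite -/p -/q -/k -/l; split; first lia.
  move: FG c0; rewrite -signr_odd hornerN; case: odd => //=; rewrite expr0; nra.
Qed.

Lemma mup_from_roots t u x : t != 0 -> mup x (from_roots t u) = count_mem x u.
Proof.
move=> t0; have P0 w : from_roots t w != 0.
  by rewrite /from_roots scaler_eq0 negb_or t0 monic_neq0 ?monic_prod_XsubC.
elim: u => [|y u IH].
  by rewrite mupNroot // /from_roots big_nil -mul_polyC mulr1 rootC.
have fE : from_roots t (y :: u) = ('X - y%:P) * from_roots t u.
  by rewrite /from_roots big_cons scalerAr.
rewrite fE mupM ?polyXsubC_eq0 // IH /= -['X - _]expr1 mup_XsubCX.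
by rewrite eq_sym; case: eqP.
Qed.

Lemma nonneg_lead_coef_gt0 f : (forall i, 0 <= f`_i) -> f != 0 -> 0 < lead_coef f.
Proof. by move=> f0 fn; rewrite lt0r lead_coef_eq0 fn lead_coefE f0. Qed.

(** By [balanced_atleast], at every level [f] has as many zeros above it as [g],
    or one more; evaluated at the zeros of [g] and of [f], this is the two halves
    of the alternation, and below all zeros it compares the degrees. *)
Lemma pick_interlaces f g : 0 < lead_coef f -> 0 < lead_coef g ->
  real_rooted f -> real_rooted g ->
  (forall z : R[i], 0 < complex.Im z -> 0 <= cross (cpoly f).[z] (cpoly g).[z]) ->
  nondegenerate_interlaces g f.
Proof.
move=> lf lg rf rg pick; split=> //.
all: have f0 : f != 0 by rewrite -lead_coef_eq0 gt_eqF.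
all: have g0 : g != 0 by rewrite -lead_coef_eq0 gt_eqF.
all: have roots p : p != 0 -> real_rooted p ->
  exists2 s, sorted >=%R s & p = from_roots (lead_coef p) s.
1,3: move=> p0 rp; have [|s _ pE] := @split_roots R (fun=> True) p p0.
1,3: by move=> z /rp[x ->]; exists x.
1,2: exists (sort >=%R s); first by apply: sort_sorted => x y; exact: le_total.
1,2: by rewrite {1}pE /from_roots; congr (_ *: _); apply: perm_big; rewrite perm_sym perm_sort.
all: have [u us fE] := roots f f0 rf; have [v vs gE] := roots g g0 rg.
all: have loc b : local_alternation u v b.
1,3: by apply: (pick_local_alternation b lf lg); rewrite -fE -gE.
  have sz t s : t != 0 -> size (from_roots t s) = (size s).+1.
    by move=> t0; rewrite /from_roots size_scale // size_prod_XsubC.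
  rewrite fE gE !sz ?gt_eqF //.
  case/andP: (balanced_size loc); rewrite leq_eqVlt => /predU1P[->|vu uv]; first by left.
  by right; congr _.+1; apply/eqP; rewrite eqn_leq uv vu.
have zl p s : 0 < lead_coef p -> sorted >=%R s -> p = from_roots (lead_coef p) s ->
    zeros_list p s.
  by move=> lp ss pE; split=> // x; rewrite {1}pE mup_from_roots // gt_eqF.
exists u, v; split; [exact: zl|exact: zl|split=> i ilt].
  apply: nth_atleast => //; case/andP: (balanced_atleast v`_i loc) => + _.
  exact: leq_trans (atleast_nth 0 vs ilt).
apply: nth_atleast => //; case/andP: (balanced_atleast u`_i.+1 loc) => _ uv.
by rewrite -ltnS; apply: leq_trans (atleast_nth 0 us ilt) uv.
Qed.

End Local.

(** * The interlacing theorem *)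

Lemma nonneg_coefM (R : numDomainType) (f g : {poly R}) :
  (forall i, 0 <= f`_i) -> (forall i, 0 <= g`_i) -> forall i, 0 <= (f * g)`_i.
Proof. by move=> f0 g0 i; rewrite coefM sumr_ge0 // => j _; rewrite mulr_ge0. Qed.

Lemma opU_coef_ge0 (R : numDomainType) r k n (h : {poly R}) : (0 < r)%N ->
  (forall i, 0 <= h`_i) -> forall i, 0 <= (opU r k n h)`_i.
Proof.
move=> r0 h0 i; rewrite coef_poly_section //.
elim: n {i}(_ + _)%N => [|n IH] i; first by rewrite mul1r.
rewrite exprS -mulrA; apply: nonneg_coefM => // j.
by rewrite coef_sum sumr_ge0 // => l _; rewrite coefXn ler0n.
Qed.

Theorem corollary3p4 (R : realType) (r n : nat) (h : {poly R})
    (r_gt0 : (0 < r)%N) (n_gt0 : (0 < n)%N)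
    (h_ge0 : forall i : nat, 0 <= h`_i)
    (h_neg : only_negative_zeros h) :
  interlacing_seq (rev [seq opU r k n h | k <- iota 0 r]).
Proof.
have h0 : h != 0.
  apply/eqP => h0; have [|x _ /eqP] := h_neg (0 +i* 1)%C.
    by rewrite h0 /cpoly rmorph0 root0.
  by rewrite eq_complex /= oner_eq0 andbF.
have [s s0 hE] := split_roots h0 h_neg.
set W : {poly R} := \sum_(i < r) 'X^i.
have turn m z : 0 < complex.Im z -> sections_turn r z (W ^+ m * h).
  move=> z0; apply: sections_turn_opU hE => //; first by rewrite lead_coef_eq0.
  by move=> u /s0/ltW.
have values k z : (k < r)%N ->
    section_values r z (W ^+ n * h) (r - k) = z * (cpoly (opU r k n h)).[z].
  exact: section_values_rev.
have nz k z : (k < r)%N -> 0 < complex.Im z -> (cpoly (opU r k n h)).[z] != 0.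
  (* One window sum is kept for last: without it, sections can vanish, as
     the [k]-sections of a constant with [k > 0] do. *)
  move=> kr z0; apply/eqP => U0; have := values k z kr; rewrite U0 mulr0 => /eqP.
  case: (n) n_gt0 => // m _; rewrite exprS -mulrA section_values_window //; apply/negP.
  by have [ft fm] := turn m z z0; exact: (turning_window_neq0 _ z0 r_gt0 ft fm).
have lead k : (k < r)%N -> 0 < lead_coef (opU r k n h).
  move=> kr; apply: nonneg_lead_coef_gt0; first exact: opU_coef_ge0.
  have /nz : 0 < complex.Im (0 +i* 1 : R[i])%C by rewrite /= ltr01.
  by move=> /(_ _ kr); apply: contraNneq => ->; rewrite /cpoly rmorph0 horner0.
have rooted k : (k < r)%N -> real_rooted (opU r k n h).
  by move=> kr; apply: nonvanishing_real_rooted => z; apply: nz.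
split=> [f|i j /andP[ij]].
  by rewrite mem_rev => /mapP[k]; rewrite mem_iota add0n => /lead ? ->; right.
rewrite size_rev size_map size_iota => jr.
have nthE l : (l < r)%N -> (rev [seq opU r k n h | k <- iota 0 r])`_l = opU r (r - l.+1) n h.
  move=> lr; rewrite nth_rev size_map size_iota // (nth_map 0%N) ?size_iota ?nth_iota //; lia.
rewrite !nthE; [|lia..]; apply: Or41.
have [ir' jr'] : (r - i.+1 < r)%N /\ (r - j.+1 < r)%N by lia.
apply: pick_interlaces; [exact: lead..|exact: rooted|exact: rooted|move=> z z0].
have zn : z != 0 by apply: contraTneq z0 => ->; rewrite /= ltxx.
rewrite -(pmulr_rge0 _ (sqnorm_gt0 zn)) -crossMM -!values //.
have [[_ At] _] := turn n z z0.
rewrite (_ : (r - (r - j.+1) = r - (r - i.+1) + (j - i))%N); last by lia.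
by apply: At; lia.
Qed.
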